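(* Let $\mathcal{C}=\langle E,c,\{\mathcal{R}_i\}_{i=1}^n\rangle$ be a covering problem, and suppose there is a polynomial-time deterministic $\alpha_{on}$-competitive online algorithm for $\mathcal{C}$. Then there is a polynomial-time algorithm which, given any $p$-system $\Omega\subseteq 2^{[n]}$ (accessed through a membership oracle), outputs a set $D\in\Omega$ such that $$\max_{B\in\Omega}\mathrm{Opt}(B)\;\le\;(p+1)\,\alpha_{on}\cdot \mathrm{Opt}(D).$$ That is, there is a $((p+1)\alpha_{on})$-approximation algorithm for the max-min problem $\max_{\omega\in\Omega}\mathrm{Opt}(\omega)$ when $\Omega$ is a $p$-system.
   Context: A covering problem $\mathcal{C}=\langle E,c,\{\mathcal{R}_i\}_{i=1}^n\rangle$ consists of a finite ground set $E$ of elements with nonnegative costs $c:E\to\mathbb{R}_{\ge 0}$ (for $F\subseteq E$ write $c(F)=\sum_{e\in F}c_e$) and $n$ requirements; requirement $i\in[n]$ is specified by an upward-closed family $\mathcal{R}_i\subseteq 2^E$, and a set $F\subseteq E$ satisfies requirement $i$ iff $F\in\mathcal{R}_i$. For $X\subseteq[n]$, $\mathrm{Opt}(X)=\min\{c(F): F\subseteq E,\ F\in\mathcal{R}_i\ \forall i\in X\}$ (the min-cost covering function). In the online version of $\mathcal{C}$, requirements from $[n]$ arrive one at a time in an arbitrary sequence $\sigma$; a deterministic online algorithm $\mathcal{A}_{on}$ maintains a set $\mathcal{A}_{on}(\sigma)\subseteq E$ satisfying every requirement that has arrived, and can only add elements, i.e. $\mathcal{A}_{on}(\sigma)\subseteq\mathcal{A}_{on}(\sigma\circ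 e)$. It is $\alpha_{on}$-competitive if $c(\mathcal{A}_{on}(\sigma))\le\alpha_{on}\cdot\mathrm{Opt}(\text{set of requirements in }\sigma)$ for every sequence $\sigma$. A family $\Omega\subseteq 2^{[n]}$ is a $p$-system if it is downward-closed (contains $\emptyset$, and $Y\subseteq X\in\Omega$ implies $Y\in\Omega$) and, for every $A\subseteq[n]$, any two maximal (with respect to inclusion) members of $\Omega$ contained in $A$ have cardinalities within a factor $p$ of each other, i.e. $\max|I|/\min|J|\le p$ over such maximal sets $I,J\subseteq A$. *)

(* Defs.v *)
From mathcomp Require Import all_boot all_order all_algebra.
Set Implicit Arguments.
Unset Strict Implicit.
Unset Printing Implicit Defensive.
Import Order.TTheory GRing.Theory Num.Theory.
Local Open Scope ring_scope.

(** * Covering problems *)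

Record covering (R : realFieldType) := Covering {
  nelt : nat;
  nreq : nat;
  ecost : 'I_nelt -> R;
  req : 'I_nreq -> {set {set 'I_nelt}};
  ecost_ge0 : forall e, 0 <= ecost e;
  req_up : forall i (F G : {set 'I_nelt}),
    F \in req i -> F \subset G -> G \in req i
}.

Definition cost (R : realFieldType) (C : covering R)
    (F : {set 'I_(nelt C)}) : R :=
  \sum_(e in F) ecost e.

Definition covers (R : realFieldType) (C : covering R)
    (F : {set 'I_(nelt C)}) (X : {set 'I_(nreq C)}) : bool :=
  [forall i in X, F \in req i].

(* The default value [cost setT] bounds every cost from above and, the families
   [req i] being upward-closed, is attained by a cover of [X] as soon as there
   is one; so this is the minimum cost of a cover of [X] whenever [X] can be
   covered, which the existence of an online algorithm guarantees. *)
Definition Opt (R : realFieldType) (C : covering R)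
    (X : {set 'I_(nreq C)}) : R :=
  \big[Num.min/cost [set: 'I_(nelt C)]]_(F : {set 'I_(nelt C)} | covers F X)
    cost F.

(* [Opt] is nonnegative and a p-system is nonempty, so that the default value 0
   does not affect the maximum. *)
Definition maxmin (R : realFieldType) (C : covering R)
    (Omega : {set {set 'I_(nreq C)}}) : R :=
  \big[Num.max/0]_(B in Omega) Opt B.

(* [s] is the sequence of requirements that have arrived so far. *)
Definition online_algorithm (R : realFieldType) (C : covering R)
    (A : seq 'I_(nreq C) -> {set 'I_(nelt C)}) : Prop :=
  (forall s i, i \in s -> A s \in req i) /\
  (forall s i, A s \subset A (rcons s i)).

Definition competitive (R : realFieldType) (C : covering R) (alpha : R)
    (A : seq 'I_(nreq C) -> {set 'I_(nelt C)}) : Prop :=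
  forall s, cost (A s) <= alpha * Opt [set i in s].

Definition maximal_in (n : nat) (Omega : {set {set 'I_n}})
    (A I : {set 'I_n}) : bool :=
  maxset (fun K : {set 'I_n} => (K \in Omega) && (K \subset A)) I.

(* The bound on |I| / |J| is multiplied out: if the empty set is maximal in A
   then it is the only member of Omega contained in A, and the quotient would
   read 0 / 0. *)
Definition p_system (R : realFieldType) (n : nat) (p : R)
    (Omega : {set {set 'I_n}}) : Prop :=
  [/\ set0 \in Omega,
      forall X Y : {set 'I_n}, X \in Omega -> Y \subset X -> Y \in Omega &
      forall A I J : {set 'I_n}, maximal_in Omega A I -> maximal_in Omega A J ->
        #|I|%:R <= p * #|J|%:R].

(** * Sizes of numbers *)

(* Costs are elements of an arbitrary ordered field; [bits x] is the space that
   the number x is charged for. The two usual conventions, the real RAM (a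
   number occupies one cell) and bit length over the rationals, are the
   instances [unit_size] and [rat_size] below. *)
Record num_size (R : realFieldType) := NumSize {
  bits :> R -> nat;
  slack : nat;
  bitsD : forall x y, (bits (x + y) <= bits x + bits y + slack)%N
}.

Definition unit_size (R : realFieldType) : num_size R :=
  @NumSize R (fun=> 0%N) 0 (fun _ _ => leqnn 0).

Definition height (x : rat) : nat := maxn `|numq x|%N `|denq x|%N.

Lemma heightD (x y : rat) :
  (height (x + y) <= 2 * (height x * height y))%N.
Proof.
have hn z : (`|numq z| <= height z)%N by apply: leq_maxl.
have hd z : (`|denq z| <= height z)%N by apply: leq_maxr.
pose u := numq x * denq y + numq y * denq x; pose v := denq x * denq y.
have v0 : v != 0 by rewrite mulf_neq0 ?denq_neq0.
have Exy : x + y = u%:~R / v%:~R.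
  rewrite -{1}(divq_num_den x) -{1}(divq_num_den y).
  by rewrite addf_div ?intr_eq0 ?denq_neq0 // /u /v !intrD !intrM.
have [k k0 [Eu Ev]] :
    exists2 k : int, k != 0 & u = k * numq (x + y) /\ v = k * denq (x + y).
  rewrite Exy; case: (divqP u v) v0 => [v0|k w k0 _]; last by exists k.
  by rewrite eqxx.
have lk : (0 < `|k|)%N by rewrite absz_gt0.
rewrite geq_max; apply/andP; split.
  apply: (@leq_trans `|u|%N); first by rewrite Eu abszM leq_pmull.
  apply: (@leq_trans (`|(numq x * denq y)%R| + `|(numq y * denq x)%R|)%N).
    by rewrite -lez_nat PoszD !abszE ler_normD.
  rewrite !abszM mul2n -addnn leq_add //; first by rewrite leq_mul.
  by rewrite [leqRHS]mulnC leq_mul.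
apply: (@leq_trans `|v|%N); first by rewrite Ev abszM leq_pmull.
by rewrite abszM mul2n -addnn (leq_trans (leq_mul (hd x) (hd y))) ?leq_addr.
Qed.

Definition rat_bits (x : rat) : nat := trunc_log 2 (height x).

Lemma rat_bitsD (x y : rat) :
  (rat_bits (x + y) <= rat_bits x + rat_bits y + 2)%N.
Proof.
have h0 z : (0 < height z)%N.
  by rewrite (leq_trans _ (leq_maxr _ _)) // absz_gt0 denq_neq0.
have /andP[lxy _] := @trunc_log_bounds 2 _ isT (h0 (x + y)).
have /andP[_ ux] := @trunc_log_bounds 2 _ isT (h0 x).
have /andP[_ uy] := @trunc_log_bounds 2 _ isT (h0 y).
rewrite -ltnS -(@ltn_exp2l 2) //.
apply: (leq_ltn_trans lxy); apply: (leq_ltn_trans (heightD x y)).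
by rewrite addn2 -addSn -addnS expnS ltn_pmul2l // expnD ltn_mul.
Qed.

Definition rat_size : num_size rat := @NumSize rat rat_bits 2 rat_bitsD.

(** * Model of computation *)

Inductive data (R : Type) : Type :=
  | Nil
  | Num of R
  | Pair of data R & data R.
Arguments Nil {R}.

Definition is_nil (R : Type) (d : data R) : bool :=
  if d is Nil then true else false.

Fixpoint dsize (R : realFieldType) (N : num_size R) (d : data R) : nat :=
  match d with
  | Nil => 1
  | Num x => (N x).+1
  | Pair a b => (dsize N a + dsize N b).+1
  end.

Definition enc_bool (R : Type) (b : bool) : data R :=
  if b then Pair Nil Nil else Nil.

Inductive instr (R : Type) : Type :=
  | Const of data R
  | Id | Fst | Snd | IsNum
  | Add | Sub | Mul | Div | Leq
  | Ask.
Arguments Id {R}.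
Arguments Fst {R}.
Arguments Snd {R}.
Arguments IsNum {R}.
Arguments Add {R}.
Arguments Sub {R}.
Arguments Mul {R}.
Arguments Div {R}.
Arguments Leq {R}.
Arguments Ask {R}.

(* [O] is the oracle. Instructions applied to ill-typed data return Nil. *)
Definition exec (R : realFieldType) (O : data R -> bool) (i : instr R)
    (d : data R) : data R :=
  match i, d with
  | Const c, _ => c
  | Id, _ => d
  | Fst, Pair a _ => a
  | Snd, Pair _ b => b
  | IsNum, Num _ => enc_bool R true
  | Add, Pair (Num x) (Num y) => Num (x + y)
  | Sub, Pair (Num x) (Num y) => Num (x - y)
  | Mul, Pair (Num x) (Num y) => Num (x * y)
  | Div, Pair (Num x) (Num y) => Num (x / y)
  | Leq, Pair (Num x) (Num y) => enc_bool R (x <= y)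
  | Ask, _ => enc_bool R (O d)
  | _, _ => Nil
  end.

Inductive prog (R : Type) : Type :=
  | Do of instr R
  | Then of prog R & prog R
  | Fork of prog R & prog R
  | If of prog R & prog R & prog R
  | While of prog R & prog R.

Fixpoint oracle_free (R : Type) (P : prog R) : bool :=
  match P with
  | Do Ask => false
  | Do _ => true
  | Then P Q | Fork P Q | While P Q => oracle_free P && oracle_free Q
  | If T P Q => [&& oracle_free T, oracle_free P & oracle_free Q]
  end.

(* [run N O P d r t]: on input [d], with oracle [O], the program [P] halts with
   result [r] in time [t]. Tests read Nil as false and anything else as true.
   Every step is charged the size of the data it reads and writes; charging one
   unit per step would let data of exponential size be built by repeatedly
   pairing a value with itself. *)
Inductive run (R : realFieldType) (N : num_size R) (O : data R -> bool) :
    prog R -> data R -> data R -> nat -> Prop :=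
  | run_Do i d :
      run N O (Do i) d (exec O i d) (dsize N d + dsize N (exec O i d))
  | run_Then P Q d a r s t :
      run N O P d a s -> run N O Q a r t ->
      run N O (Then P Q) d r (dsize N d + s + t)
  | run_Fork P Q d a b s t :
      run N O P d a s -> run N O Q d b t ->
      run N O (Fork P Q) d (Pair a b) (dsize N d + s + t)
  | run_If_true T P Q d b r s t :
      run N O T d b s -> ~~ is_nil b -> run N O P d r t ->
      run N O (If T P Q) d r (dsize N d + s + t)
  | run_If_false T P Q d b r s t :
      run N O T d b s -> is_nil b -> run N O Q d r t ->
      run N O (If T P Q) d r (dsize N d + s + t)
  | run_While_stop T P d b s :
      run N O T d b s -> is_nil b ->
      run N O (While T P) d d (dsize N d + s)
  | run_While_step T P d b e r s t u :
      run N O T d b s -> ~~ is_nil b -> run N O P d e t ->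
      run N O (While T P) e r u ->
      run N O (While T P) d r (dsize N d + s + t + u).

Lemma run_det (R : realFieldType) (N : num_size R) (O : data R -> bool)
    (P : prog R) (d r r' : data R) (t t' : nat) :
  run N O P d r t -> run N O P d r' t' -> r = r' /\ t = t'.
Proof.
move=> H; elim: H r' t' => {P d r t}; intros;
  match goal with H : run _ _ _ _ ?r ?t |- _ = ?r /\ _ = ?t => inversion H end;
  subst; try (repeat match goal with
  | IH : forall r t, run _ _ ?P ?d r t -> _ = r /\ _ = t,
    H : run _ _ ?P ?d _ _ |- _ => case: (IH _ _ H) => *; clear IH; subst
  end); by [| match goal with
            | H : is_true (is_nil ?b), H' : is_true (~~ is_nil ?b) |- _ =>
              rewrite H in H' end].
Qed.

(** * Encodings *)

Definition enc_list (R : Type) (s : seq (data R)) : data R :=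
  foldr (@Pair R) Nil s.

Definition enc_nat (R : Type) (n : nat) : data R := iter n (Pair Nil) Nil.

Definition enc_seq (R : Type) (n : nat) (s : seq 'I_n) : data R :=
  enc_list [seq enc_nat R i | i : 'I_n <- s].

(* incidence vector *)
Definition enc_set (R : Type) (n : nat) (X : {set 'I_n}) : data R :=
  enc_list [seq enc_bool R (i \in X) | i <- enum 'I_n].

(* [desc] is the problem-specific description of the requirements (the subsets
   of a set cover instance, the graph and the terminals of a Steiner tree
   instance, ...). Programs that have no use for it simply pass it on. *)
Definition enc_covering (R : realFieldType) (C : covering R) (desc : data R) :
    data R :=
  Pair (enc_nat R (nreq C))
    (Pair (enc_list [seq Num (ecost e) | e <- enum 'I_(nelt C)]) desc).

(** * Polynomial-time algorithms *)

Definition runs_within (R : realFieldType) (N : num_size R)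
    (O : data R -> bool) (P : prog R) (k : nat) (d r : data R) : Prop :=
  exists2 t, run N O P d r t & (t <= k * dsize N d ^ k + k)%N.

(* A covering problem is a class [I] of instances; [A x] maps each sequence of
   arrived requirements of the instance [x] to the current solution. *)
Definition polytime_online (R : realFieldType) (N : num_size R) (I : Type)
    (C : I -> covering R) (desc : I -> data R)
    (A : forall x, seq 'I_(nreq (C x)) -> {set 'I_(nelt (C x))}) : Prop :=
  exists (P : prog R) (k : nat), oracle_free P /\
    forall O x (s : seq 'I_(nreq (C x))),
      runs_within N O P k
        (Pair (enc_covering (C x) (desc x)) (enc_seq R s)) (enc_set R (A x s)).

Definition membership_oracle (R : Type) (n : nat) (O : data R -> bool)
    (Omega : {set {set 'I_n}}) : Prop :=
  forall X : {set 'I_n}, O (enc_set R X) = (X \in Omega).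

(* Main.v *)
(* The algorithm is greedy: starting from the empty sequence, it repeatedly
   appends to the requirements s = g_1 ... g_k arrived so far an element e that
   keeps the set in Omega and maximizes the cost of A(s, e), until no such e is
   left; it returns D = {g_1, ..., g_l}.

   Put m_k = cost A(g_1 ... g_(k+1)) - cost A(g_1 ... g_k), and fix B in Omega.
   Let d(b) be the last step at which b in B \ D could still be added. For every
   k, the set {g_1, ..., g_k} is maximal in its union with {b | d(b) < k}, so
   d(b) < k for at most p k elements b. At any step j <= d(b) the greedy choice
   was at least as expensive as b, so covering b on top of A(g_1 ... g_j) costs
   at most m_j; choosing the cheapest j <= d(b), this is the running minimum of m
   at d(b), which is nonincreasing in d(b). Summation by parts bounds the total
   by p (m_0 + ... + m_(l-1)) <= p cost A(D), and A(D) together with these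
   increments covers B.

   For the running time, programs without loops are linear, a fold over a list
   multiplies by the length of the list, and all sizes are bounded by a fixed
   power of the size of the instance. As only the sizes of sums of costs are
   controlled, the program compares the costs of the A(s, e) instead of the
   increments, which have the same order. *)
Require Import Defs.
From mathcomp Require Import all_boot all_order all_algebra.
From mathcomp Require Import zify lra.
Import Order.TTheory GRing.Theory Num.Theory.
(* Reimported because MathComp shadows some of its names, such as [Nil]. *)
Import Defs.
Set Implicit Arguments.
Unset Strict Implicit.
Unset Printing Implicit Defensive.
Local Open Scope ring_scope.

(** * Greedy on a p-system *)

Section Greedy.
Variables (R : realFieldType).

Fixpoint run_min (m : nat -> R) k : R :=
  if k is k'.+1 then Num.min (run_min m k') (m k) else m 0%N.

Lemma run_min_le m k : run_min m k <= m k.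
Proof. by case: k => //= k; rewrite ge_min lexx orbT. Qed.

Lemma run_min_ge0 m k : (forall j, 0 <= m j) -> 0 <= run_min m k.
Proof. by move=> h; elim: k => //= k IH; rewrite le_min IH h. Qed.

Lemma run_min_attained m k : exists2 j, (j <= k)%N & run_min m k = m j.
Proof.
elim: k => [|k [j jk E]]; first by exists 0%N.
rewrite /=; case: (leP (run_min m k) (m k.+1)) => _; last by exists k.+1.
by exists j; rewrite // leqW.
Qed.

(* Summation by parts; replacing [m] by its running minimum makes it
   nonincreasing. *)
Lemma sum_run_min_le (T : finType) (X : {set T}) (d : T -> nat) (p : R)
    (m : nat -> R) l :
    (forall j, 0 <= m j) ->
    (forall k, (k <= l)%N -> #|[set b in X | (d b < k)%N]|%:R <= p * k%:R) ->
    (forall b, b \in X -> (d b < l)%N) ->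
  \sum_(b in X) run_min m (d b) <= p * \sum_(j < l) m j.
Proof.
move=> m0 hp dl.
pose n k : R := #|[set b in X | (d b < k)%N]|%:R.
pose S k := \sum_(b in X | (d b < k)%N) run_min m (d b).
have key k : (k <= l)%N ->
    S k + (p * k%:R - n k) * run_min m k <= p * \sum_(j < k) run_min m j.
  elim: k => [|k IH] kl.
    have -> : S 0%N = 0 by apply: big_pred0 => b; rewrite andbF.
    have -> : n 0%N = 0.
      rewrite /n (_ : [set _ in _ | _] = set0) ?cards0 //.
      by apply/setP => b; rewrite !inE andbF.
    by rewrite big_ord0 !mulr0 subr0 mul0r addr0.
  have ltSk b : (b \in X) && (d b < k.+1)%N && (d b < k)%N =
                (b \in X) && (d b < k)%N.
    by rewrite ltnS -andbA; case: ltnP => [/ltnW->|]; rewrite ?andbF.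
  have -> : S k.+1 = S k + (n k.+1 - n k) * run_min m k.
    rewrite /S (bigID (fun b => (d b < k)%N)) /=; congr (_ + _).
      exact: eq_bigl.
    rewrite (eq_bigr (fun=> run_min m k)); last first.
      move=> b /andP[/andP[_]]; rewrite ltnS -leqNgt => h1 h2.
      by congr run_min; apply/eqP; rewrite eqn_leq h1.
    rewrite sumr_const -mulr_natl; congr (_ * _).
    rewrite /n.
    rewrite -(cardsID [set b | (d b < k)%N] [set b in X | (d b < k.+1)%N]) natrD.
    rewrite (_ : _ :&: _ = [set b in X | (d b < k)%N]); last first.
      by apply/setP => b; rewrite !inE.
    rewrite addrAC subrr add0r; congr (_%:R); apply: eq_card => b.
    by rewrite !inE /in_mem /= andbC.
  have h1 := IH (ltnW kl); have h2 := hp _ kl; rewrite -/(n k.+1) in h2.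
  rewrite big_ord_recr /= mulrDr.
  have h3 : run_min m k.+1 <= run_min m k by rewrite /= ge_min lexx.
  have h4 : 0 <= (p * k.+1%:R - n k.+1) by rewrite subr_ge0.
  have := ler_wpM2l h4 h3; rewrite -natr1 /= in h4 *; lra.
have -> : \sum_(b in X) run_min m (d b) = S l.
  by apply: eq_bigl => b; case: (boolP (b \in X)) => //= /dl ->.
have h1 : 0 <= (p * l%:R - n l) * run_min m l.
  by rewrite mulr_ge0 ?run_min_ge0 // subr_ge0 hp.
have hp0 : 0 <= p * \sum_(j < l) m j -  p * \sum_(j < l) run_min m j.
  case: (posnP l) => [-> | l0]; first by rewrite !big_ord0 subrr.
  (* [hp] at [l > 0] bounds a cardinality by [p * l], which fixes the sign of [p]. *)
  have p0 : 0 <= p.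
    rewrite -(pmulr_lge0 _ (_ : 0 < l%:R)) ?ltr0n //.
    by rewrite (le_trans _ (hp l _)) ?ler0n.
  rewrite -mulrBr mulr_ge0 // subr_ge0 ler_sum // => j _; exact: run_min_le.
have := key l (leqnn _); lra.
Qed.
End Greedy.

(** * Costs of covers and the greedy guarantee *)

Section CoveringCost.
Variables (R : realFieldType) (C : covering R).
Implicit Types (F G : {set 'I_(nelt C)}) (X B : {set 'I_(nreq C)}).

Lemma cost_ge0 F : 0 <= cost F.
Proof. by apply: sumr_ge0 => e _; apply: ecost_ge0. Qed.

Lemma costD F G : F \subset G -> cost (G :\: F) = cost G - cost F.
Proof.
move=> /setIidPr FG; rewrite /cost [in RHS](big_setID F) /= FG.
by rewrite addrAC subrr add0r.
Qed.

Lemma cost_subset F G : F \subset G -> cost F <= cost G.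
Proof. by move=> /costD h; rewrite -subr_ge0 -h cost_ge0. Qed.

Lemma costU F G : cost (F :|: G) <= cost F + cost G.
Proof.
rewrite /cost (big_setID F) /= setIUl setIid (setUidPl _) ?subsetIr // lerD2l.
by rewrite setDUl setDv set0U cost_subset ?subsetDl.
Qed.

Lemma cost_bigcup (T : finType) (P : {pred T}) (F : T -> {set 'I_(nelt C)}) :
  cost (\bigcup_(b in P) F b) <= \sum_(b in P) cost (F b).
Proof.
elim/big_rec2: _ => [|b x G _ IH]; first by rewrite /cost big_set0.
by rewrite (le_trans (costU _ _)) // lerD2l.
Qed.

Lemma Opt_le F X : covers F X -> Opt X <= cost F.
Proof. by move=> h; apply: bigmin_le_cond. Qed.

Lemma Opt_ge0 X : 0 <= Opt X.
Proof. by apply: le_bigmin => *; apply: cost_ge0. Qed.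

Lemma Opt0 : Opt (set0 : {set 'I_(nreq C)}) = 0.
Proof.
apply/le_anti; rewrite Opt_ge0 andbT.
have <- : cost (set0 : {set 'I_(nelt C)}) = 0 by rewrite /cost big_set0.
by apply: Opt_le; apply/forall_inP => i; rewrite inE.
Qed.

Variables (A : seq 'I_(nreq C) -> {set 'I_(nelt C)}) (onA : online_algorithm A).

Lemma online_take s j : A (take j s) \subset A (take j.+1 s).
Proof.
case: (ltnP j (size s)) => h; last by rewrite !take_oversize // leqW.
case: s h => // x s h; rewrite [take j.+1 _](take_nth x h); exact: onA.2.
Qed.

Lemma online_subset s j : A (take j s) \subset A s.
Proof.
rewrite -{2}(take_size s).
case: (leqP j (size s)) => [/subnK|/ltnW h]; last first.
  by rewrite take_size take_oversize.
move: (size s - j)%N => k; elim: k (size s) => [|k IH] n <- //.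
exact: subset_trans (IH _ erefl) (online_take _ _).
Qed.

(** Excluding members of [s] keeps greedy sequences free of repetitions, so that a prefix of length
    [k] is a set of cardinality [k]. *)
Definition candidate (Omega : {set {set 'I_(nreq C)}}) (s : seq 'I_(nreq C))
    (e : 'I_(nreq C)) : bool :=
  (e \notin s) && (e |: [set i in s] \in Omega).

(** Optimality of the choices is stated for total costs; as the competing solutions all extend
    [A (take k s)], it is also optimality of the increments. *)
Lemma greedy_bound (p : R) (Omega : {set {set 'I_(nreq C)}}) s :
    p_system p Omega -> 0 <= p -> uniq s -> [set i in s] \in Omega ->
    (forall k e, (k < size s)%N -> candidate Omega (take k s) e ->
      cost (A (rcons (take k s) e)) <= cost (A (take k.+1 s))) ->
    (forall e, ~~ candidate Omega s e) ->
  forall B, B \in Omega -> Opt B <= (p + 1) * cost (A s).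
Proof.
move=> [Om0 down psys] p0 us Oms greedy final B OmB.
pose G k := cost (A (take k s)); pose m k := G k.+1 - G k.
pose l := size s; pose addable k b := b |: [set i in take k s] \in Omega.
have m0 k : 0 <= m k by rewrite subr_ge0 cost_subset ?online_take.
have addable_le j k b : (j <= k)%N -> addable k b -> addable j b.
  move=> jk h; apply: down h _; apply: setUS; apply/subsetP => i; rewrite !inE.
  by rewrite -(take_takel s jk) => /mem_take.
pose X := B :\: [set i in s].
have X0 b : b \in X -> addable 0%N b.
  rewrite !inE => /andP[_ bB]; apply: down OmB _; rewrite take0.
  by apply/subsetP => i; rewrite !inE orbF => /eqP->.
have Xl b : b \in X -> ~~ addable l b.
  rewrite !inE /addable take_size => /andP[bs _].
  by have := final b; rewrite /candidate bs.
(* An empty maximum would be 0; for [b] in [X] this is ruled out, since [X0] and [Xl] give [l > 0]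
   and index 0 qualifies. *)
pose d b := (\max_(k < l | addable k b) k)%N.
have dP b : b \in X -> (d b < l)%N /\ addable (d b) b.
  move=> bX; have l0 : (0 < l)%N.
    by have := Xl b bX; rewrite lt0n; apply: contraNneq => ->; apply: X0.
  have : (0 < #|[pred k : 'I_l | addable k b]|)%N.
    by apply/card_gt0P; exists (Ordinal l0); rewrite inE; apply: X0.
  by case/(eq_bigmax_cond (fun k : 'I_l => k : nat)) => k kP E; rewrite /d E.
have dlt b k : b \in X -> (k <= l)%N -> (d b < k)%N -> ~~ addable k b.
  move=> bX; rewrite leq_eqVlt => /predU1P[-> _|kl]; first exact: Xl.
  apply: contraL => h; rewrite -leqNgt.
  exact: (@leq_bigmax_cond _ _ (fun k : 'I_l => k : nat) (Ordinal kl)).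
have dcard k : (k <= l)%N -> #|[set b in X | (d b < k)%N]|%:R <= p * k%:R.
  move=> kl; set Y := [set b in X | _].
  pose Z := [set i in take k s] :|: Y.
  have maxs : maximal_in Omega Z [set i in take k s].
    apply/maxsetP; split.
      rewrite subsetUl andbT; apply: down Oms _.
      by apply/subsetP => i; rewrite !inE => /mem_take.
    move=> K /andP[OmK KZ] sK; apply/eqP; rewrite eqEsubset sK andbT.
    apply/subsetP => b bK; move/subsetP/(_ b bK): (KZ).
    case/setUP => // /setIdP[bX] /(dlt _ _ bX kl)/negP[]; apply: down OmK _.
    by rewrite subUset sub1set bK.
  have YB : Y \subset B by apply/subsetP => b; rewrite !inE => /andP[/andP[]].
  (* [Y] lies in [Omega] as a subset of [B], so it extends to a maximal [I] inside [Z]; comparing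
     [I] with the first [k] choices gives [#|Y| <= #|I| <= p * k]. *)
  have [|I maxI YI] :=
      @maxset_exists _ (fun K => (K \in Omega) && (K \subset Z)) Y.
    by rewrite (down _ _ OmB YB) subsetUr.
  have := psys Z I _ maxI maxs; rewrite cardsE (card_uniqP _) ?take_uniq //.
  rewrite size_takel //; apply: le_trans.
  by rewrite ler_nat subset_leq_card.
have pick b : b \in X -> exists2 j : 'I_l, addable j b & m j = run_min m (d b).
  move=> /dP[dl dA]; have [j jd E] := run_min_attained m (d b).
  by exists (Ordinal (leq_ltn_trans jd dl)) => //; apply: addable_le dA.
(* What is bought for [b], at a step attaining the running minimum; the fact [pick] shows that the
   default [setT] does not occur on [X]. *)
pose step b : {set 'I_(nelt C)} :=
  if [pick j : 'I_l | addable j b && (m j == run_min m (d b))] is Some j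
  then A (rcons (take j s) b) :\: A (take j s) else setT.
have stepP b : b \in X ->
    cost (step b) <= run_min m (d b) /\ A s :|: step b \in req b.
  move=> bX; rewrite /step; case: pickP => [j /andP[jA /eqP <-]|no]; last first.
    by have [j jA E] := pick b bX; have := no j; rewrite jA E eqxx.
  split.
    rewrite costD ?onA.2 // lerD2r; apply: greedy (ltn_ord j) _.
    rewrite /candidate [_ \in Omega]jA andbT; move: bX; rewrite !inE.
    by case/andP=> bs _; apply: contra bs => /mem_take.
  apply: req_up (onA.1 (rcons (take j s) b) b _) _.
    by rewrite mem_rcons inE eqxx.
  apply/subsetP => e eA; rewrite !inE eA andbT.
  case: (boolP (e \in A (take j s))); last by rewrite orbT.
  by move/(subsetP (online_subset _ _))->.
pose F := A s :|: \bigcup_(b in X) step b.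
have covF : covers F B.
  apply/forall_inP => b bB; case: (boolP (b \in s)) => bs.
    by apply: req_up (onA.1 s b bs) _; apply: subsetUl.
  have bX : b \in X by rewrite !inE bs.
  by apply: req_up (stepP b bX).2 _; apply: setUS; apply: bigcup_sup.
apply: le_trans (Opt_le covF) _; apply: le_trans (costU _ _) _.
rewrite mulrDl mul1r addrC lerD2r; apply: le_trans (cost_bigcup _ _) _.
apply: le_trans (ler_sum _ (fun b bX => (stepP b bX).1)) _.
apply: le_trans (sum_run_min_le m0 dcard (fun b bX => (dP b bX).1)) _.
(* The increments telescope to [G l - G 0], and [G 0] is nonnegative. *)
rewrite ler_wpM2l // -(big_mkord xpredT) telescope_sumr // /G /l take_size.
by rewrite lerBlDr lerDl cost_ge0.
Qed.

End CoveringCost.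

Local Open Scope nat_scope.

(** * Polynomial-time programs *)

Section Programs.
Variables (R : realFieldType) (N : num_size R).
Implicit Types (O : data R -> bool) (P Q T : prog R) (d r a : data R).

Lemma dsize_gt0 d : 0 < dsize N d.
Proof. by case: d. Qed.

(** Each step pays for the data it reads and writes, so a time bound doubles as a bound on the sizes
    of input and result. *)
Lemma run_dsize O P d r t : run N O P d r t -> dsize N d <= t /\ dsize N r <= t.
Proof.
elim=> {P d r t} /= *; repeat match goal with H : _ /\ _ |- _ => case: H => * end;
  by match goal with |- context [dsize N ?d + _] => have := dsize_gt0 d end; lia.
Qed.

(** A program without loops always halts, with a result that is a function of its input. The value
    at [While] is a placeholder, outside the [straight] programs. *)
Fixpoint eval O P d : data R :=
  match P with
  | Do i => exec O i d
  | Then P Q => eval O Q (eval O P d)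
  | Fork P Q => Pair (eval O P d) (eval O Q d)
  | If T P Q => if is_nil (eval O T d) then eval O Q d else eval O P d
  | While _ _ => d
  end.

(* [bitsD] controls the sizes of sums only; the results of the other arithmetic
   operations may be arbitrarily large. *)
Fixpoint straight (P : prog R) : bool :=
  match P with
  | Do (Sub | Mul | Div) => false
  | Do _ => true
  | Then P Q | Fork P Q => straight P && straight Q
  | If T P Q => [&& straight T, straight P & straight Q]
  | While _ _ => false
  end.

Lemma straight_linear P : straight P ->
  exists c, forall O d,
    exists2 t, run N O P d (eval O P d) t & t <= c * dsize N d.
Proof.
elim: P => [i|P IHP Q IHQ|P IHP Q IHQ|T IHT P IHP Q IHQ|//] /=.
- move=> si.
  have [c hc] : exists c, forall O d, dsize N (exec O i d) <= c * dsize N d.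
    case: i si => [c||||||||||] //= _.
    + exists (dsize N c) => O d; exact: leq_pmulr (dsize_gt0 d).
    + by exists 1 => O d; rewrite mul1n.
    + exists 1 => O d; rewrite mul1n; case: d => //= a b.
      by rewrite ltnW // ltnS leq_addr.
    + exists 1 => O d; rewrite mul1n; case: d => //= a b.
      by rewrite ltnW // ltnS leq_addl.
    + by exists 3 => O [|x|a b] //=; lia.
    + exists (slack N).+1 => O [|x|[|x|u v] [|y|u' v']] //=.
      by have := bitsD N x y; lia.
    + exists 3 => O [|x|[|x|u v] [|y|u' v']] //=.
      by case: (x <= y)%R => //=; lia.
    + by exists 3 => O d; have := dsize_gt0 d; case: (O d) => /=; lia.
  exists c.+1 => O d; eexists; first exact: run_Do.
  by rewrite mulSn leq_add2l.
- case/andP=> /IHP[cP hP] /IHQ[cQ hQ]; exists (1 + cP + cQ * cP) => O d.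
  have [s rs ls] := hP O d; have [t rt lt] := hQ O (eval O P d).
  eexists; first exact: run_Then rs rt.
  rewrite !mulnDl mul1n !leq_add // (leq_trans lt) // -mulnA leq_mul //.
  by rewrite (leq_trans _ ls) // (run_dsize rs).2.
- case/andP=> /IHP[cP hP] /IHQ[cQ hQ]; exists (1 + cP + cQ) => O d.
  have [s rs ls] := hP O d; have [t rt lt] := hQ O d.
  eexists; first exact: run_Fork rs rt.
  by rewrite !mulnDl mul1n !leq_add.
- case/and3P=> /IHT[cT hT] /IHP[cP hP] /IHQ[cQ hQ].
  exists (1 + cT + (cP + cQ)) => O d.
  have [s rs ls] := hT O d.
  have [t rt lt] := hP O d; have [u ru lu] := hQ O d.
  case: ifPn => b; eexists; first exact: run_If_false rs b ru.
  - by rewrite !mulnDl mul1n !leq_add // (leq_trans lu) // leq_addl.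
  - exact: run_If_true rs b rt.
  - by rewrite !mulnDl mul1n !leq_add // (leq_trans lt) // leq_addr.
Qed.

(** The loop state pairs the remaining list with the accumulator. The test [Fst] yields that list,
    so the loop stops when it is [Nil]; [P] maps the head paired with the accumulator to the next
    accumulator. *)
Definition Fold P : prog R :=
  Then
    (While (Do Fst)
      (Fork (Then (Do Fst) (Do Snd))
        (Then (Fork (Then (Do Fst) (Do Fst)) (Do Snd)) P)))
    (Do Snd).

(** Naming all accumulators in advance by [acc] lets the body be verified one iteration at a time.
    The [20] generously covers the bookkeeping of an iteration; [(size s).+2] counts the iterations,
    the last test and the final projection. *)
Lemma run_Fold O P (s : seq (data R)) (acc : nat -> data R) m K :
    (forall i, i <= size s -> dsize N (acc i) <= m) ->
    (forall i, i < size s ->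
      exists2 t, run N O P (Pair (nth Nil s i) (acc i)) (acc i.+1) t & t <= K) ->
  exists2 t, run N O (Fold P) (Pair (enc_list s) (acc 0)) (acc (size s)) t &
    t <= (size s).+2 * (20 * (dsize N (enc_list s) + m).+1 + K).
Proof.
move=> hm hP.
have [t rt lt] : exists2 t,
   run N O (While (Do Fst)
      (Fork (Then (Do Fst) (Do Snd))
        (Then (Fork (Then (Do Fst) (Do Fst)) (Do Snd)) P)))
      (Pair (enc_list s) (acc 0)) (Pair Nil (acc (size s))) t &
    t <= (size s).+1 * (20 * (dsize N (enc_list s) + m).+1 + K).
  elim: s acc hm hP => [|x s IH] acc hm hP.
    have h0 := hm 0 isT; eexists.
      by apply: run_While_stop; [exact: run_Do|].
    by rewrite /= in h0 *; lia.
  have [t1 rt1 lt1] := hP 0 isT.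
  have [t2 rt2 lt2] :=
    IH (fun i => acc i.+1) (fun i => hm i.+1) (fun i => hP i.+1).
  have h0 := hm 0 isT; have hx := dsize_gt0 x.
  eexists.
    apply: run_While_step rt2; first exact: run_Do; first by [].
    apply: run_Fork; first by apply: run_Then; exact: run_Do.
    apply: run_Then rt1; apply: run_Fork; last exact: run_Do.
    by apply: run_Then; exact: run_Do.
  rewrite /= in h0 lt2 *.
  set D := dsize N (enc_list s) in lt2 *; set X := dsize N x in hx *.
  set A := dsize N (acc 0) in h0 *.
  have le2 : (size s).+1 * (20 * (D + m).+1 + K) <=
             (size s).+1 * (20 * ((X + D).+1 + m).+1 + K).
    by rewrite leq_mul2l /= leq_add2r leq_mul2l /=; lia.
  rewrite [X in _ <= X]mulSn; move: (leq_trans lt2 le2); set Z := (size s).+1 * _.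
  lia.
eexists; first exact: run_Then rt (run_Do _ _ _ _).
have /= h := hm (size s) (leqnn _); have h0 := hm 0 isT.
rewrite [X in _ <= X]mulSn; move: lt; set Z := (size s).+1 * _.
rewrite /=; lia.
Qed.

End Programs.

(** * Polynomial time over families of inputs *)

Section PolynomialTime.
Variables (R : realFieldType) (N : num_size R).

(** An index stands for one call of a program. Time is measured against [scale], which stays fixed
    through all subprograms, rather than against the immediate input, so that bounds for consecutive
    programs combine. *)
Record tasks := Tasks {
  idx :> Type;
  dom : idx -> Prop;
  scale : idx -> nat;
  orc : idx -> data R -> bool
}.

(* The exponent is quantified before the index, so that the bound is uniform. *)
Definition pbounded (F : tasks) (f : F -> nat) : Prop :=
  exists k, forall w, dom w -> f w <= (scale w).+2 ^ k.

Definition ptime (F : tasks) (P : prog R) (inp out : F -> data R) : Prop :=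
  exists k, forall w, dom w ->
    exists2 t, run N (orc w) P (inp w) (out w) t & t <= (scale w).+2 ^ k.

(** A branch of a conditional has to be correct only on the indices that reach it. *)
Definition restrict (F : tasks) (b : pred F) : tasks :=
  @Tasks F (fun w => dom w /\ b w) (@scale F) (@orc F).

Section Rules.
Variable F : tasks.
Implicit Types (f g : F -> nat) (inp mid out : F -> data R) (P Q T : prog R).

Lemma pbounded_le f g :
  pbounded g -> (forall w, dom w -> f w <= g w) -> pbounded f.
Proof.
by move=> [k hk] h; exists k => w dw; rewrite (leq_trans (h w dw)) ?hk.
Qed.

Lemma pbounded_const n : pbounded (fun _ : F => n).
Proof.
(* The base [(scale w).+2] is at least 2, and [n < 2 ^ n]. *)
exists n => w _; rewrite (leq_trans (ltnW (ltn_expl n (isT : 1 < 2)))) //.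
by case: n => // n; rewrite leq_exp2r.
Qed.

Lemma pbounded_scale : pbounded (@scale F).
Proof. by exists 1 => w _; rewrite expn1 leqW // leqW. Qed.

Lemma pboundedM f g : pbounded f -> pbounded g -> pbounded (fun w => f w * g w).
Proof.
move=> [k hk] [l hl]; exists (k + l) => w dw.
by rewrite expnD leq_mul ?hk ?hl.
Qed.

Lemma pboundedX f n : pbounded f -> pbounded (fun w => f w ^ n).
Proof.
move=> [k hk]; exists (k * n) => w dw; rewrite expnM.
by case: n => // n; rewrite leq_exp2r ?hk.
Qed.

Lemma pboundedD f g : pbounded f -> pbounded g -> pbounded (fun w => f w + g w).
Proof.
(* The extra exponent absorbs the factor 2 from two summands. *)
move=> [k hk] [l hl]; exists (maxn k l).+1 => w dw; rewrite expnS.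
have h j : j <= maxn k l -> (scale w).+2 ^ j <= (scale w).+2 ^ maxn k l.
  by move=> hj; rewrite leq_pexp2l.
have := leq_trans (hk w dw) (h k (leq_maxl _ _)).
have := leq_trans (hl w dw) (h l (leq_maxr _ _)).
move: ((scale w).+2 ^ maxn k l) => m; nia.
Qed.

Lemma ptime_intro f P inp out : pbounded f ->
    (forall w, dom w ->
      exists2 t, run N (orc w) P (inp w) (out w) t & t <= f w) ->
  ptime P inp out.
Proof.
move=> [k hk] h; exists k => w dw; have [t rt lt] := h w dw.
by exists t => //; rewrite (leq_trans lt) ?hk.
Qed.

Lemma ptime_elim P inp out : ptime P inp out ->
  exists2 f, pbounded f & forall w, dom w ->
    exists2 t, run N (orc w) P (inp w) (out w) t & t <= f w.
Proof. by move=> [k hk]; exists (fun w => (scale w).+2 ^ k) => //; exists k. Qed.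

(** With [ptime_out], this reads size bounds for intermediate data off the running times of the
    programs that handle them. *)
Lemma ptime_inp P inp out :
  ptime P inp out -> pbounded (fun w => dsize N (inp w)).
Proof.
move=> [k h]; exists k => w dw; have [t rt lt] := h w dw.
by rewrite (leq_trans (run_dsize rt).1).
Qed.

Lemma ptime_out P inp out :
  ptime P inp out -> pbounded (fun w => dsize N (out w)).
Proof.
move=> [k h]; exists k => w dw; have [t rt lt] := h w dw.
by rewrite (leq_trans (run_dsize rt).2).
Qed.

Lemma ptime_straight P inp out : straight P ->
    pbounded (fun w => dsize N (inp w)) ->
    (forall w, dom w -> eval (orc w) P (inp w) = out w) ->
  ptime P inp out.
Proof.
move=> /(straight_linear N)[c hc] hi ho.
apply: (ptime_intro (pboundedM (pbounded_const c) hi)) => w dw.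
by rewrite -ho //; apply: hc.
Qed.

Lemma ptime_then P Q inp mid out :
  ptime P inp mid -> ptime Q mid out -> ptime (Then P Q) inp out.
Proof.
move=> hP hQ; have hi := ptime_inp hP.
have [f hf {}hP] := ptime_elim hP; have [g hg {}hQ] := ptime_elim hQ.
apply: (ptime_intro (pboundedD (pboundedD hi hf) hg)) => w dw.
have [s rs ls] := hP w dw; have [t rt lt] := hQ w dw.
by eexists; [exact: run_Then rs rt|rewrite !leq_add].
Qed.

Lemma ptime_fork P Q inp mid out :
  ptime P inp mid -> ptime Q inp out ->
  ptime (Fork P Q) inp (fun w => Pair (mid w) (out w)).
Proof.
move=> hP hQ; have hi := ptime_inp hP.
have [f hf {}hP] := ptime_elim hP; have [g hg {}hQ] := ptime_elim hQ.
apply: (ptime_intro (pboundedD (pboundedD hi hf) hg)) => w dw.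
have [s rs ls] := hP w dw; have [t rt lt] := hQ w dw.
by eexists; [exact: run_Fork rs rt|rewrite !leq_add].
Qed.

Lemma ptime_ext P inp inp' out out' :
    (forall w, dom w -> inp w = inp' w) -> (forall w, dom w -> out w = out' w) ->
  ptime P inp out -> ptime P inp' out'.
Proof.
by move=> hi ho [k h]; exists k => w dw; rewrite -hi -?ho //; apply: h.
Qed.

End Rules.

Lemma ptime_if (F : tasks) (T P Q : prog R) (inp out : F -> data R)
    (b : pred F) :
    ptime T inp (fun w => enc_bool R (b w)) ->
    @ptime (restrict b) P inp out -> @ptime (restrict (predC b)) Q inp out ->
  ptime (If T P Q) inp out.
Proof.
move=> hT [k hP] [l hQ]; have hi := ptime_inp hT.
have [f hf {}hT] := ptime_elim hT.
have hk m : pbounded (fun w : F => (scale w).+2 ^ m) by exists m.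
apply: (ptime_intro (pboundedD (pboundedD hi hf) (pboundedD (hk k) (hk l)))).
move=> w dw; have [s rs ls] := hT w dw.
case bw: (b w) rs => rs.
  have [t rt lt] := hP w (conj dw bw).
  eexists; first exact: run_If_true rs _ rt.
  by rewrite !leq_add // (leq_trans lt) ?leq_addr.
have [t rt lt] := hQ w (conj dw (negbT bw)).
eexists; first exact: run_If_false rs _ rt.
by rewrite !leq_add // (leq_trans lt) ?leq_addl.
Qed.

(** Reindexing: a bound for [F] covers any family whose calls already occur in [F] at the same
    scale. *)
Lemma ptime_sub (F G : tasks) (P : prog R) (inp out : F -> data R)
    (inp' out' : G -> data R) :
    (forall v : G, dom v -> exists w : F,
      [/\ dom w, scale w = scale v, orc w = orc v, inp w = inp' v &
          out w = out' v]) ->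
  ptime P inp out -> ptime P inp' out'.
Proof.
move=> h [k hk]; exists k => v dv.
by have [w [dw <- <- <- <-]] := h v dv; apply: hk.
Qed.

(** One index per iteration of a fold, all at the scale of the whole fold, so that a polynomial
    bound on this family is uniform over the iterations. *)
Definition stages (F : tasks) (s : F -> seq (data R)) : tasks :=
  @Tasks (F * nat) (fun w => dom w.1 /\ w.2 < size (s w.1))
    (fun w => scale w.1) (fun w => orc w.1).

Lemma ptime_fold (F : tasks) (P : prog R) (s : F -> seq (data R))
    (acc : F -> nat -> data R) :
    pbounded (fun w => dsize N (enc_list (s w))) ->
    pbounded (fun w => dsize N (acc w 0)) ->
    @ptime (stages s) P (fun w => Pair (nth Nil (s w.1) w.2) (acc w.1 w.2))
      (fun w => acc w.1 w.2.+1) ->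
  ptime (Fold P) (fun w => Pair (enc_list (s w)) (acc w 0))
    (fun w => acc w (size (s w))).
Proof.
move=> hs ha [k hP].
have size_enc (t : seq (data R)) : size t <= dsize N (enc_list t).
  by elim: t => //= d t; have := dsize_gt0 N d; lia.
have hk : pbounded (fun w : F => (scale w).+2 ^ k) by exists k.
have c := @pbounded_const F.
apply: (ptime_intro (pboundedM (pboundedD hs (c 2))
  (pboundedD (pboundedM (c 20) (pboundedD hs
    (pboundedD (pboundedD ha hk) (c 1)))) hk))) => w dw.
(* Every accumulator but the first is a result of the body, so its size is at most the time of one
   iteration; growth does not compound over the loop. *)
have hm i : i <= size (s w) ->
    dsize N (acc w i) <= dsize N (acc w 0) + (scale w).+2 ^ k.
  case: i => [|i] hi; first by rewrite leq_addr.
  have [t rt lt] := hP (w, i) (conj dw hi).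
  by rewrite (leq_trans (run_dsize rt).2) // (leq_trans lt) ?leq_addl.
have {}hP i : i < size (s w) ->
    exists2 t, run N (orc w) P (Pair (nth Nil (s w) i) (acc w i)) (acc w i.+1) t
             & t <= (scale w).+2 ^ k.
  by move=> hi; apply: hP (w, i) (conj dw hi).
have [t rt lt] := run_Fold hm hP.
exists t => //; rewrite (leq_trans lt) // addn2 addn1 addnS.
by rewrite leq_mul2r !ltnS size_enc orbT.
Qed.

Lemma dsize_enc_list (s : seq (data R)) :
  dsize N (enc_list s) = (sumn [seq (dsize N d).+1 | d <- s]).+1.
Proof. by elim: s => //= d s ->; rewrite addnS. Qed.

Lemma dsize_enc_list_cat (s t : seq (data R)) :
  dsize N (enc_list (s ++ t)) + 1 = dsize N (enc_list s) + dsize N (enc_list t).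
Proof. by rewrite !dsize_enc_list map_cat sumn_cat; lia. Qed.

Lemma dsize_enc_list_take i (s : seq (data R)) :
  dsize N (enc_list (take i s)) <= dsize N (enc_list s).
Proof.
have := dsize_enc_list_cat (take i s) (drop i s); rewrite cat_take_drop.
by have := dsize_gt0 N (enc_list (drop i s)); lia.
Qed.

Lemma dsize_enc_list_drop i (s : seq (data R)) :
  dsize N (enc_list (drop i s)) <= dsize N (enc_list s).
Proof.
have := dsize_enc_list_cat (take i s) (drop i s); rewrite cat_take_drop.
by have := dsize_gt0 N (enc_list (take i s)); lia.
Qed.

Lemma dsize_enc_list_rev (s : seq (data R)) :
  dsize N (enc_list (rev s)) = dsize N (enc_list s).
Proof. by rewrite !dsize_enc_list map_rev sumn_rev. Qed.

(** A head paired with an accumulator already is the accumulator with that head prepended, so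
    folding the identity reverses one list onto another. *)
Lemma ptime_catrev (F : tasks) (s t : F -> seq (data R)) :
    pbounded (fun w => dsize N (enc_list (s w))) ->
    pbounded (fun w => dsize N (enc_list (t w))) ->
  ptime (Fold (Do Id)) (fun w => Pair (enc_list (s w)) (enc_list (t w)))
    (fun w => enc_list (catrev (s w) (t w))).
Proof.
move=> hs ht.
pose acc (w : F) i := enc_list (rev (take i (s w)) ++ t w).
apply: (@ptime_ext _ _ (fun w => Pair (enc_list (s w)) (acc w 0)) _
  (fun w => acc w (size (s w)))).
- by move=> w _; rewrite /acc take0.
- by move=> w _; rewrite /acc take_size catrevE.
apply: ptime_fold => //.
  by apply: pbounded_le ht _ => w _; rewrite /acc take0.
have nth_acc (w : stages s) : dom w ->
    Pair (nth Nil (s w.1) w.2) (acc w.1 w.2) = acc w.1 w.2.+1.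
  by case: w => w i [_ /= hi]; rewrite /acc (take_nth Nil hi) rev_rcons.
apply: ptime_straight => //.
have [k hk] := pboundedD hs ht; exists k => w dw; rewrite nth_acc //.
have := hk w.1 dw.1; rewrite /acc.
have := dsize_enc_list_cat (rev (take w.2.+1 (s w.1))) (t w.1).
rewrite dsize_enc_list_rev /=.
by have := dsize_enc_list_take w.2.+1 (s w.1); lia.
Qed.

(** The fold runs over incidence bits; its accumulator holds the costs not yet read and the sum so
    far, so both lists are traversed in step. *)
Definition weigh : prog R :=
  Fold (Fork (Then (Do Snd) (Then (Do Fst) (Do Snd)))
    (If (Do Fst)
      (Then (Fork (Then (Do Snd) (Do Snd))
                  (Then (Do Snd) (Then (Do Fst) (Do Fst)))) (Do Add))
      (Then (Do Snd) (Do Snd)))).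

(** Each addition contributes the bits of the summand plus [slack N], while each entry adds its bits
    and at least one unit to the list size; the factor [(slack N).+1] pays for both. *)
Lemma bits_weight (l : seq (bool * R)) :
  N (\sum_(x <- l | x.1) x.2)%R <=
  N 0%R + (slack N).+1 * dsize N (enc_list [seq Defs.Num x.2 | x <- l]).
Proof.
elim: l => [|[b r] l IH]; first by rewrite big_nil; lia.
rewrite big_cons /=; move: IH; set D := dsize N _; set z := N 0%R => IH.
case: b; last by rewrite (leq_trans IH) // leq_add2l leq_mul2l /=; lia.
rewrite (leq_trans (bitsD N _ _)) // mulSn mulnS mulnDr; move: IH; rewrite mulSn.
move: (slack N * D) (slack N * (N r).+1) (N r) (N _) => u v n m; lia.
Qed.

Lemma ptime_weigh (F : tasks) (l : F -> seq (bool * R)) :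
    pbounded (fun w => dsize N (enc_list [seq Defs.Num x.2 | x <- l w])) ->
  ptime weigh
    (fun w => Pair (enc_list [seq enc_bool R x.1 | x <- l w])
      (Pair (enc_list [seq Defs.Num x.2 | x <- l w]) (Defs.Num 0%R)))
    (fun w => Pair Nil (Defs.Num (\sum_(x <- l w | x.1) x.2)%R)).
Proof.
move=> hl.
pose acc (w : F) i := Pair (enc_list (drop i [seq Defs.Num x.2 | x <- l w]))
  (Defs.Num (\sum_(x <- take i (l w) | x.1) x.2)%R).
have hacc : pbounded (F := stages (fun w => [seq enc_bool R x.1 | x <- l w]))
  (fun w => dsize N (Pair (nth Nil [seq enc_bool R x.1 | x <- l w.1] w.2)
                       (acc w.1 w.2))).
  have [k hk] := pboundedD (pboundedM (pbounded_const _ (slack N).+2) hl)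
    (pbounded_const _ (N 0%R + 6)).
  exists k => w dw; apply: leq_trans (hk _ dw.1) => /=.
  have hb : dsize N (nth Nil [seq enc_bool R x.1 | x <- l w.1] w.2) <= 3.
    case: dw; rewrite size_map => _ hw.
    by rewrite (nth_map (false, 0%R)) //; case: (_.1).
  have := dsize_enc_list_drop w.2 [seq Defs.Num x.2 | x <- l w.1].
  have htake := dsize_enc_list_take w.2 [seq Defs.Num x.2 | x <- l w.1].
  have := bits_weight (take w.2 (l w.1)); rewrite map_take => hsum.
  have := leq_trans hsum (leq_add (leqnn _) (leq_mul (leqnn _) htake)).
  move: hb; rewrite [(slack N).+2 * _]mulSn; move: ((slack N).+1 * _) (N 0%R).
  move: (N (\sum_(x <- _ | _) _)%R) (dsize N (nth _ _ _)); lia.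
apply: (@ptime_ext _ _
  (fun w => Pair (enc_list [seq enc_bool R x.1 | x <- l w]) (acc w 0)) _
  (fun w => acc w (size [seq enc_bool R x.1 | x <- l w]))).
- by move=> w _; rewrite /acc take0 drop0 big_nil.
- move=> w _; rewrite /acc size_map take_size drop_oversize //.
  by rewrite size_map.
apply: ptime_fold.
- apply: pbounded_le (pboundedM (pbounded_const _ 3) hl) _ => w _.
  rewrite !dsize_enc_list; elim: (l w) => //= -[[] r] s /=; lia.
- apply: pbounded_le (pboundedD hl (pbounded_const _ (N 0%R).+2)) _ => w _.
  by rewrite /acc take0 drop0 big_nil /=; lia.
apply: (ptime_straight _ hacc) => // -[w i] [_]; rewrite size_map => /= hi.
rewrite /acc (drop_nth Nil) ?size_map //= (take_nth (false, 0%R)) //.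
rewrite !(nth_map (false, 0%R)) //= big_rcons /=.
by case: (nth _ _ _) => -[] r; rewrite /= ?GRing.addr0.
Qed.

End PolynomialTime.

(** * The greedy algorithm *)

Section Scan.
Variables (R : realFieldType) (C : covering R).
Variable A : seq 'I_(nreq C) -> {set 'I_(nelt C)}.
Variable Omega : {set {set 'I_(nreq C)}}.
Implicit Types (s : seq 'I_(nreq C)) (e : 'I_(nreq C)).

Definition value s e : R := cost (A (rcons s e)).

Definition better s (b : option 'I_(nreq C)) e : option 'I_(nreq C) :=
  if candidate Omega s e &&
     (if b is Some e' then (value s e' <= value s e)%R else true)
  then Some e else b.

Definition best s i := foldl (better s) None (take i (enum 'I_(nreq C))).

Definition greedy_step s : seq 'I_(nreq C) :=
  if best s (nreq C) is Some e then rcons s e else s.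

Lemma bestP s :
  if best s (nreq C) is Some e
  then candidate Omega s e /\
       forall e', candidate Omega s e' -> (value s e' <= value s e)%R
  else forall e, ~~ candidate Omega s e.
Proof.
have E : best s (nreq C) = foldl (better s) None (enum 'I_(nreq C)).
  by rewrite /best take_oversize // size_enum_ord.
rewrite E.
have : forall e, e \in enum 'I_(nreq C) by move=> e; rewrite mem_enum.
have : if foldl (better s) None (enum 'I_(nreq C)) is Some e
  then candidate Omega s e /\
       {in enum 'I_(nreq C), forall e',
         candidate Omega s e' -> (value s e' <= value s e)%R}
  else {in enum 'I_(nreq C), forall e, ~~ candidate Omega s e}.
  elim/last_ind: (enum _) => [|l e IH] //=; rewrite foldl_rcons {1}/better.
  case: (foldl _ _ l) IH => [b [cb IH]|IH].
    case: (boolP (candidate Omega s e)) => /= ce; last first.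
      split=> // e'; rewrite mem_rcons inE => /predU1P[->|]; last exact: IH.
      by rewrite (negPf ce).
    case: ifPn => [le_be|]; rewrite -?ltNge; last move/ltW => le_eb.
      split=> // e'; rewrite mem_rcons inE => /predU1P[->|e'l ce'] //.
      exact: le_trans (IH _ e'l ce') le_be.
    by split=> // e'; rewrite mem_rcons inE => /predU1P[->|] //; apply: IH.
  case: (boolP (candidate Omega s e)) => /= ce.
    split=> // e'; rewrite mem_rcons inE => /predU1P[->|e'l] //.
    by rewrite (negPf (IH _ e'l)).
  by move=> e'; rewrite mem_rcons inE => /predU1P[->|] //; apply: IH.
case: (foldl _ _ _) => [b [cb h] hin|h hin e]; last exact: h.
by split=> // e'; apply: h.
Qed.

Definition greedy_seq i := iter i greedy_step [::].

Lemma uniq_greedy_seq i : uniq (greedy_seq i).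
Proof.
elim: i => //= i IH; rewrite /greedy_step; have := bestP (greedy_seq i).
by case: (best _ _) => // e [/andP[es _] _]; rewrite rcons_uniq es IH.
Qed.

Lemma set_rcons s e : [set i in rcons s e] = e |: [set i in s].
Proof. by apply/setP => i; rewrite !inE mem_rcons inE. Qed.

Lemma greedy_seq_in i : set0 \in Omega -> [set j in greedy_seq i] \in Omega.
Proof.
move=> Om0; elim: i => [|i IH] /=.
  by rewrite (_ : [set j in _] = set0) //; apply/setP => j; rewrite !inE.
rewrite /greedy_step; have := bestP (greedy_seq i).
by case: (best _ _) => // e [/andP[_ h] _]; rewrite set_rcons.
Qed.

(** Later rounds only append, so the choice made after the prefix of length [k] is preserved. *)
Lemma greedy_seq_greedy i k e :
    k < size (greedy_seq i) -> candidate Omega (take k (greedy_seq i)) e ->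
  (cost (A (rcons (take k (greedy_seq i)) e)) <=
   cost (A (take k.+1 (greedy_seq i))))%R.
Proof.
elim: i => //= i IH; rewrite /greedy_step; have := bestP (greedy_seq i).
case: (best _ _) => // b [cb hb]; rewrite size_rcons ltnS leq_eqVlt.
case/predU1P=> [->|ki].
  have -> : take (size (greedy_seq i)) (rcons (greedy_seq i) b) = greedy_seq i.
    by rewrite -cats1 take_size_cat.
  by rewrite take_oversize ?size_rcons //; apply: hb.
by rewrite -cats1 !takel_cat // 1?ltnW //; apply: IH.
Qed.

(** Either every round appended an element, and a sequence of length [nreq C] without repetitions
    contains all requirements, or some round found no candidate and the sequence has stayed the same
    since. *)
Lemma greedy_seq_final e : ~~ candidate Omega (greedy_seq (nreq C)) e.
Proof.
have h i :
    size (greedy_seq i) = i \/ forall e, ~~ candidate Omega (greedy_seq i) e.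
  elim: i => [|i IH] /=; first by left.
  rewrite /greedy_step; have := bestP (greedy_seq i).
  case E: (best _ _) => [b|]; last by right.
  case: IH => [IH _|IH [cb _]]; first by left; rewrite size_rcons IH.
  by have := IH b; rewrite cb.
case: (h (nreq C)) => // hs; rewrite /candidate negb_and negbK.
apply/orP; left; have := uniq_min_size (uniq_greedy_seq (nreq C))
  (s2 := enum 'I_(nreq C)).
rewrite size_enum_ord hs => -[|//|_ ->]; last by rewrite mem_enum.
by move=> i; rewrite mem_enum.
Qed.

End Scan.

Lemma ptime_then_straight (R : realFieldType) (N : num_size R) (F : tasks R)
    (P Q : prog R) (inp mid out : F -> data R) :
    ptime N P inp mid -> straight Q ->
    (forall w, dom w -> eval (orc w) Q (mid w) = out w) ->
  ptime N (Then P Q) inp out.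
Proof.
move=> hP sQ hQ; have hm := ptime_out hP.
by apply: ptime_then hP _; apply: ptime_straight.
Qed.

(** * Encodings of sets, sequences and costs *)

Section Encodings.
Variables (R : realFieldType) (N : num_size R).

(** This allows a unary number to drive a [Fold] as a loop counter. *)
Lemma enc_list_nseq n : enc_list (nseq n Nil) = enc_nat R n.
Proof. by elim: n => //= n ->. Qed.

(** As [false] is encoded by [Nil], the number of requirements doubles as the vector of the empty
    set, where the greedy run starts. *)
Lemma enc_set0 n : enc_set R (set0 : {set 'I_n}) = enc_nat R n.
Proof.
rewrite -[in RHS](size_enum_ord n) /enc_set.
by elim: (enum _) => //= i s ->; rewrite inE.
Qed.

Lemma dsize_enc_nat n : dsize N (enc_nat R n) = n.*2.+1.
Proof. by elim: n => //= n ->. Qed.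

Lemma dsize_enc_set n (X : {set 'I_n}) : dsize N (enc_set R X) <= 4 * n + 1.
Proof.
rewrite /enc_set dsize_enc_list -[X in 4 * X](size_enum_ord n).
by elim: (enum _) => //= i s; case: (_ \in _) => /=; lia.
Qed.

Lemma dsize_enc_seq n (s : seq 'I_n) :
  dsize N (enc_seq R s) <= size s * (2 * n + 2) + 1.
Proof.
rewrite /enc_seq dsize_enc_list; elim: s => //= i s.
by rewrite dsize_enc_nat; have := ltn_ord i; nia.
Qed.

Lemma dsize_enc_seq_rev n (s : seq 'I_n) :
  dsize N (enc_seq R (rev s)) = dsize N (enc_seq R s).
Proof. by rewrite /enc_seq map_rev dsize_enc_list_rev. Qed.

Lemma dsize_enc_seq_rcons n (s : seq 'I_n) e :
  dsize N (enc_seq R (rcons s e)) = dsize N (enc_seq R s) + e.*2.+2.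
Proof.
rewrite -dsize_enc_seq_rev rev_rcons -(dsize_enc_seq_rev s) /enc_seq /=.
by rewrite dsize_enc_nat addnC !addnS.
Qed.

Definition incidence n (X : {set 'I_n}) : seq (data R) :=
  [seq enc_bool R (i \in X) | i <- enum 'I_n].

Lemma size_incidence n (X : {set 'I_n}) : size (incidence X) = n.
Proof. by rewrite size_map size_enum_ord. Qed.

Lemma nth_incidence n (X : {set 'I_n}) (i : 'I_n) :
  nth Nil (incidence X) i = enc_bool R (i \in X).
Proof. by rewrite (nth_map i) ?size_enum_ord // nth_ord_enum. Qed.

(** The shape in which the program assembles the vector of a candidate set from the zipper. *)
Lemma incidenceU1 n (X : {set 'I_n}) (e : 'I_n) :
  incidence (e |: X) =
  take e (incidence X) ++ enc_bool R true :: drop e.+1 (incidence X).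
Proof.
have hs : size (take e (incidence X)) = e.
  by rewrite size_takel // size_incidence ltnW.
apply: (@eq_from_nth _ Nil).
  by rewrite size_cat hs /= size_drop !size_incidence; have := ltn_ord e; lia.
rewrite size_incidence => i hi; rewrite (nth_incidence _ (Ordinal hi)) !inE.
rewrite nth_cat hs -val_eqE /=; case: (ltngtP i e) => [ie|ei|ie].
- by rewrite nth_take // (nth_incidence _ (Ordinal hi)).
- have -> : i - e = (i - e.+1).+1 by lia.
  by rewrite /= nth_drop subnKC // (nth_incidence _ (Ordinal hi)).
- by have -> : i - e = 0 by lia.
Qed.

Definition weighted (C : covering R) (F : {set 'I_(nelt C)}) : seq (bool * R) :=
  [seq (e \in F, ecost e) | e <- enum 'I_(nelt C)].

Lemma weighted1 (C : covering R) (F : {set 'I_(nelt C)}) :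
  enc_list [seq enc_bool R x.1 | x <- weighted F] = enc_set R F.
Proof. by rewrite /weighted -map_comp. Qed.

Lemma weighted2 (C : covering R) (F : {set 'I_(nelt C)}) :
  [seq Defs.Num x.2 | x <- weighted F] =
  [seq Defs.Num (ecost e) | e <- enum 'I_(nelt C)].
Proof. by rewrite /weighted -map_comp. Qed.

Lemma cost_weighted (C : covering R) (F : {set 'I_(nelt C)}) :
  cost F = (\sum_(x <- weighted F | x.1) x.2)%R.
Proof. by rewrite big_map big_enum_cond. Qed.

End Encodings.

Definition access (R : Type) (s : seq (instr R)) : prog R :=
  foldr (fun i => Then (Do i)) (Do Id) s.

(** * The greedy program and its running time *)

Section Algorithm.
Variables (R : realFieldType) (N : num_size R) (I : Type).
Variables (C : I -> covering R) (desc : I -> data R).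
Variable A : forall x, seq 'I_(nreq (C x)) -> {set 'I_(nelt (C x))}.
Variable online : prog R.

(* The access paths of these programs follow the layouts of [probe_inp] and
   [enc_state] below. *)
Definition current_sequence : prog R :=
  Then
    (Fork (Fork (access [:: Snd; Fst])
                (access [:: Snd; Snd; Snd; Snd; Snd; Snd; Snd]))
          (Do (Const Nil)))
    (Fold (Do Id)).

Definition start_weighing : prog R :=
  Fork (access [:: Fst])
    (Fork (access [:: Snd]) (Do (Const (Defs.Num 0%R)))).

Definition compute_value : prog R :=
  Then (Then (Then
    (Fork (access [:: Snd; Snd; Snd; Snd; Snd; Fst]) current_sequence)
    (Fork online (access [:: Fst; Snd; Fst])))
    start_weighing)
    (Then (weigh R) (access [:: Snd])).

Definition compute_candidate : prog R :=
  Then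
    (Fork (access [:: Snd; Snd; Snd; Fst])
      (Fork (Do (Const (Pair Nil Nil))) (access [:: Snd; Snd; Fst; Snd])))
    (Fold (Do Id)).

Definition test_candidate : prog R :=
  If (access [:: Snd; Snd; Snd; Fst; Fst])
    (Do (Const Nil)) (access [:: Fst; Ask]).

Definition update_best : prog R :=
  If (If (access [:: Snd; Snd; Snd; Snd; Snd; Snd; Fst])
       (Then (Fork (access [:: Snd; Snd; Snd; Snd; Snd; Snd; Fst; Fst])
                   (access [:: Fst])) (Do Leq))
       (Do (Const (Pair Nil Nil))))
    (Fork (access [:: Fst])
      (Fork (access [:: Snd; Fst])
        (Fork (access [:: Snd; Snd; Snd; Fst])
              (access [:: Snd; Snd; Snd; Snd; Snd; Snd; Snd; Snd; Snd]))))
    (access [:: Snd; Snd; Snd; Snd; Snd; Snd; Fst]).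

Definition advance : prog R :=
  Fork (Fork (Do (Const Nil)) (access [:: Snd; Snd; Fst]))
    (Fork (access [:: Snd; Snd; Snd; Fst; Snd])
      (Fork (Fork (access [:: Snd; Snd; Snd; Fst; Fst])
                  (access [:: Snd; Snd; Snd; Snd; Fst]))
        (Fork (access [:: Fst])
              (access [:: Snd; Snd; Snd; Snd; Snd; Snd])))).

Definition probe_step : prog R :=
  Then
    (Then (Fork compute_candidate (Do Id))
      (Fork
        (If test_candidate
          (Then (Fork (Then (Do Snd) compute_value) (Do Id)) update_best)
          (access [:: Snd; Snd; Snd; Snd; Snd; Fst]))
        (Do Snd)))
    advance.

Definition greedy_round : prog R :=
  Then (Then
    (Fork (access [:: Snd; Fst; Fst])
      (Fork (Do (Const Nil)) (Fork (access [:: Snd; Snd; Fst])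
        (Fork (Do (Const Nil)) (Fork (Do (Const Nil)) (access [:: Snd]))))))
    (Fold probe_step))
    (If (access [:: Snd; Snd; Snd; Fst])
      (Fork (access [:: Snd; Snd; Snd; Snd; Fst])
            (access [:: Snd; Snd; Snd; Fst; Snd]))
      (access [:: Snd; Snd; Snd; Snd])).

Definition greedy_program : prog R :=
  Then (Then
    (Fork (access [:: Fst])
      (Fork (Do Id) (Fork (access [:: Fst]) (Do (Const Nil)))))
    (Fold greedy_round))
    (access [:: Snd; Fst]).

Record state := State {
  inst : I;
  member : data R -> bool;
  system : {set {set 'I_(nreq (C inst))}};
  chosen : seq 'I_(nreq (C inst))
}.

(** The scale is the size of the instance alone. Requiring [uniq] bounds the length of [chosen] by
    the number of requirements, which keeps encoded states polynomial in the scale. *)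
Definition states : tasks R :=
  @Tasks R state
    (fun w => membership_oracle (member w) (system w) /\ uniq (chosen w))
    (fun w => dsize N (enc_covering (C (inst w)) (desc (inst w)))) member.

Record probe := Probe {
  at_state :> state;
  element : 'I_(nreq (C (inst at_state)));
  best_so_far : option 'I_(nreq (C (inst at_state)))
}.

Definition probes : tasks R :=
  @Tasks R probe (fun v => @dom _ states v) (fun v => @scale _ states v)
    (fun v => member v).

Notation chosen_set w := [set i in chosen w].

(** The sequence is kept in reverse, so that a choice is recorded by one [Pair]; the set is kept
    beside it for oracle queries and the output. *)
Definition enc_state (w : state) : data R :=
  Pair (enc_covering (C (inst w)) (desc (inst w)))
    (Pair (enc_set R (chosen_set w)) (enc_seq R (rev (chosen w)))).

(** Next to the value stands the set and reversed sequence that result from choosing [e], so that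
    the end of a round merely projects them out. *)
Definition enc_best (w : state) (b : option 'I_(nreq (C (inst w)))) : data R :=
  if b is Some e then
    Pair (Defs.Num (value (@A _) (chosen w) e))
      (Pair (enc_set R (e |: chosen_set w))
        (Pair (enc_nat R e) (enc_seq R (rev (chosen w)))))
  else Nil.

(* A zipper: the incidence vector of the chosen set is split at position [i],
   the part before [i] being reversed, so that the vector of [e |: chosen_set w]
   at [i = e] is one [catrev] away. *)
Definition enc_scan (w : state) (i : nat) b : data R :=
  Pair (enc_nat R i)
    (Pair (enc_list (drop i (incidence R (chosen_set w))))
      (Pair (enc_list (rev (take i (incidence R (chosen_set w)))))
        (Pair (@enc_best w b) (enc_state w)))).

Definition probe_inp (v : probes) : data R :=
  Pair Nil (enc_scan (element v) (best_so_far v)).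

Lemma nreq_le_scale (w : states) : (nreq (C (inst w))) <= scale w.
Proof. by rewrite /= dsize_enc_nat; lia. Qed.

Lemma dsize_value (w : state) e :
  N (value (@A _) (chosen w) e) <=
  N 0%R + (slack N).+1 * dsize N (enc_covering (C (inst w)) (desc (inst w))).
Proof.
rewrite /value cost_weighted (leq_trans (bits_weight _ _)) // leq_add2l leq_mul2l /=.
by rewrite weighted2 /=; lia.
Qed.

Lemma dsize_enc_chosen (w : states) : dom w ->
  dsize N (enc_seq R (rev (chosen w))) <=
  2 * (scale w * scale w) + 2 * scale w + 1.
Proof.
case=> _ /card_uniqP us; rewrite (leq_trans (dsize_enc_seq _ _)) // size_rev -us.
have hn := nreq_le_scale w; have := max_card (mem (chosen w)); rewrite card_ord.
move=> /leq_trans/(_ hn) hs.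
have := leq_mul hs (leq_add (leq_mul (leqnn 2) hn) (leqnn 2)).
move: (_ * (2 * nreq _ + 2)) (scale w) => u v; nia.
Qed.

Lemma dsize_enc_state (w : states) : dom w ->
  dsize N (enc_state w) <= 2 * (scale w * scale w) + 7 * scale w + 4.
Proof.
move=> dw; have h := dsize_enc_chosen dw; have := dsize_enc_set N (chosen_set w).
have := nreq_le_scale w.
have -> : dsize N (enc_state w) = (scale w + (dsize N (enc_set R (chosen_set w)) +
            dsize N (enc_seq R (rev (chosen w)))).+1).+1 by [].
lia.
Qed.

Lemma dsize_enc_scan (w : states) i b : dom w -> i <= nreq (C (inst w)) ->
  dsize N (@enc_scan w i b) <=
  4 * (scale w * scale w) + (slack N).+1 * scale w + 40 * scale w + N 0%R + 40.
Proof.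
move=> dw hi; have hst := dsize_enc_state dw; have hch := dsize_enc_chosen dw.
have hset X := dsize_enc_set N (X : {set 'I_(nreq (C (inst w)))}).
have hn := nreq_le_scale w.
pose v := incidence R (chosen_set w).
have hd := leq_trans (dsize_enc_list_drop N i v) (hset _).
have ht := leq_trans (dsize_enc_list_take N i v) (hset _).
have hb : dsize N (@enc_best w b) <=
    2 * (scale w * scale w) + (slack N).+1 * scale w + 10 * scale w + N 0%R + 10.
  case: b => [e|]; last by rewrite /= !addnS.
  have := @dsize_value w e; have := hset (e |: chosen_set w); have := ltn_ord e.
  have -> : dsize N (@enc_best w (Some e)) = (N (value (@A _) (chosen w) e)).+1 +
    (dsize N (enc_set R (e |: chosen_set w)) +
      (dsize N (enc_nat R e) + dsize N (enc_seq R (rev (chosen w)))).+1).+1.+1.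
    by rewrite /= !addnS.
  rewrite dsize_enc_nat -[dsize N (enc_covering _ _)]/(scale w).
  by move: ((slack N).+1 * _) (N (value _ _ _)) (N 0%R) => t u z; lia.
have -> : dsize N (@enc_scan w i b) = (dsize N (enc_nat R i) +
    (dsize N (enc_list (drop i v)) +
      (dsize N (enc_list (rev (take i v))) +
        (dsize N (@enc_best w b) + dsize N (enc_state w)).+1).+1).+1).+1 by [].
rewrite dsize_enc_nat dsize_enc_list_rev.
by move: ((slack N).+1 * _) (N 0%R) hb => t u; lia.
Qed.

Lemma pbounded_scan (F : tasks R) (f : F -> nat) (h : F -> states)
    (i : F -> nat) (b : forall w, option 'I_(nreq (C (inst (h w))))) :
    (forall w, dom w -> [/\ dom (h w), scale w = scale (h w),
       i w <= nreq (C (inst (h w))) &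
       f w <= dsize N (enc_scan (i w) (b w)) + 2]) ->
  pbounded f.
Proof.
move=> hf; have S := @pbounded_scale _ F; have c := @pbounded_const _ F.
apply: (pbounded_le (pboundedD (pboundedM (c 4) (pboundedM S S))
  (pboundedD (pboundedM (c (slack N).+1) S)
    (pboundedD (pboundedM (c 40) S) (c (N 0%R + 42)))))).
move=> w dw; have [dh -> hi hw] := hf w dw; apply: leq_trans hw _.
have := dsize_enc_scan (b w) dh hi.
by move: ((slack N).+1 * _) (N 0%R) => u v; lia.
Qed.

Lemma pbounded_probe : pbounded (fun v : probes => dsize N (probe_inp v)).
Proof.
apply: (@pbounded_scan probes (fun v => dsize N (probe_inp v))
  (fun v => at_state v) (fun v => element v) (fun v => best_so_far v)) => v dv.
by split=> //; [rewrite ltnW|rewrite /=; lia].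
Qed.

Variable k : nat.
Hypothesis onlineP : forall O x (s : seq 'I_(nreq (C x))),
  runs_within N O online k
    (Pair (enc_covering (C x) (desc x)) (enc_seq R s)) (enc_set R (@A x s)).

(** The online program is polynomial in its own input, whose size is at most quadratic in the
    scale. *)
Lemma ptime_online : @ptime R N probes online
  (fun v => Pair (enc_covering (C (inst v)) (desc (inst v)))
              (enc_seq R (rcons (chosen v) (element v))))
  (fun v => enc_set R (@A _ (rcons (chosen v) (element v)))).
Proof.
have S := @pbounded_scale _ probes; have c := @pbounded_const _ probes.
have h : pbounded (fun v : probes => dsize N (Pair
    (enc_covering (C (inst v)) (desc (inst v)))
    (enc_seq R (rcons (chosen v) (element v))))).
  apply: (pbounded_le (pboundedD (pboundedM (c 2) (pboundedM S S))
    (pboundedD (pboundedM (c 5) S) (c 4)))) => v dv.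
  have := dsize_enc_chosen dv; have := ltn_ord (element v).
  have := nreq_le_scale (v : states); rewrite dsize_enc_seq_rev.
  have -> : dsize N (Pair (enc_covering (C (inst v)) (desc (inst v)))
      (enc_seq R (rcons (chosen v) (element v)))) =
    (scale v + dsize N (enc_seq R (rcons (chosen v) (element v)))).+1 by [].
  by rewrite dsize_enc_seq_rcons -[@scale _ probes v]/(@scale _ states v); lia.
apply: (ptime_intro (pboundedD (pboundedM (c k) (pboundedX k h)) (c k))) => v dv.
exact: onlineP.
Qed.

Lemma ptime_value : @ptime R N probes compute_value probe_inp
  (fun v => Defs.Num (value (@A _) (chosen v) (element v))).
Proof.
have hin := pbounded_probe.
pose costs (v : probes) :=
  enc_list [seq Defs.Num (ecost e) | e <- enum 'I_(nelt (C (inst v)))].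
pose arrived (v : probes) := rcons (chosen v) (element v).
pose l (v : probes) := weighted (@A _ (arrived v)).
(* Prepending the tested element to the reversed sequence and reversing onto [Nil] restores the
   order of arrival. *)
have h1 : ptime N current_sequence probe_inp (fun v => enc_seq R (arrived v)).
  pose s (v : probes) := [seq enc_nat R (i : 'I_(_)) | i <- rev (arrived v)].
  have hs : @ptime R N probes
      (Fork (Fork (access [:: Snd; Fst])
                  (access [:: Snd; Snd; Snd; Snd; Snd; Snd; Snd]))
            (Do (Const Nil)))
      probe_inp (fun v => Pair (enc_list (s v)) (enc_list [::])).
    by apply: ptime_straight => // v _; rewrite /s rev_rcons.
  have hout := ptime_out hs; apply: ptime_then hs _.
  apply: (@ptime_ext _ _ _ _ _ _ (fun v => enc_list (catrev (s v) [::]))) => //.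
    by move=> v _; rewrite catrevE cats0 -map_rev revK.
  apply: ptime_catrev; last exact: pbounded_const.
  by apply: pbounded_le hout _ => v _ /=; lia.
have h2 : @ptime R N probes (access [:: Snd; Snd; Snd; Snd; Snd; Fst]) probe_inp
    (fun v => enc_covering (C (inst v)) (desc (inst v))).
  by apply: ptime_straight.
have h3 := ptime_fork h2 h1.
have h4 : @ptime R N probes (access [:: Fst; Snd; Fst])
   (fun v => Pair (enc_covering (C (inst v)) (desc (inst v)))
              (enc_seq R (arrived v))) costs.
  by apply: ptime_straight => //; apply: ptime_out h3.
have h5 := ptime_then h3 (ptime_fork ptime_online h4).
have h6 := ptime_then_straight h5 (isT : straight start_weighing)
  (fun w _ => erefl).
apply: ptime_then h6 _.
apply: (@ptime_then _ _ _ _ _ _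
  (fun v => Pair Nil (Defs.Num (\sum_(x <- l v | x.1) x.2)%R))).
  apply: (@ptime_ext _ _ _ _
    (fun v => Pair (enc_list [seq enc_bool R x.1 | x <- l v])
      (Pair (enc_list [seq Defs.Num x.2 | x <- l v]) (Defs.Num 0%R)))) => //.
    by move=> v _; rewrite weighted1 weighted2.
  apply: ptime_weigh.
  by apply: pbounded_le (ptime_out h4) _ => v _; rewrite weighted2.
apply: ptime_straight => // [|v _]; last by rewrite -cost_weighted.
have S := @pbounded_scale _ probes; have c := @pbounded_const _ probes.
apply: (pbounded_le (pboundedD (pboundedM (c (slack N).+1) S)
  (c (N 0%R + 3)))) => v _.
rewrite -cost_weighted; have := @dsize_value v (element v).
rewrite /scale /= /value -/(arrived v).
by move: ((slack N).+1 * _) (N _) (N 0%R); lia.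
Qed.

Definition candidate_at (v : probes) : bool :=
  candidate (system v) (chosen v) (element v).

Definition new_best (v : probes) :=
  better (@A _) (system v) (chosen v) (best_so_far v) (element v).

Definition candidate_set (v : probes) : data R :=
  enc_set R (element v |: chosen_set v).

Lemma drop_incidence (v : probes) :
  drop (element v) (incidence R (chosen_set v)) =
  enc_bool R (element v \in chosen v) ::
    drop (element v).+1 (incidence R (chosen_set v)).
Proof. by rewrite (drop_nth Nil) ?size_incidence // nth_incidence inE. Qed.

Lemma ptime_candidate : ptime N compute_candidate probe_inp candidate_set.
Proof.
pose s (v : probes) :=
  rev (take (element v) (incidence R (chosen_set v))).
pose t (v : probes) :=
  enc_bool R true :: drop (element v).+1 (incidence R (chosen_set v)).
have hs : @ptime R N probes
   (Fork (access [:: Snd; Snd; Snd; Fst])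
      (Fork (Do (Const (Pair Nil Nil))) (access [:: Snd; Snd; Fst; Snd])))
   probe_inp (fun v => Pair (enc_list (s v)) (enc_list (t v))).
  apply: ptime_straight => // [|v _]; first exact: pbounded_probe.
  by rewrite /probe_inp /enc_scan drop_incidence.
have hout := ptime_out hs; apply: ptime_then hs _.
apply: (@ptime_ext _ _ _ _ _ _ (fun v => enc_list (catrev (s v) (t v)))) => //.
  by move=> v _; rewrite catrevE revK -incidenceU1.
by apply: ptime_catrev; apply: pbounded_le hout _ => v _ /=; lia.
Qed.

Lemma ptime_restrict (F : tasks R) (b : pred F) P (inp out : F -> data R) :
  ptime N P inp out -> @ptime R N (restrict b) P inp out.
Proof. by apply: ptime_sub => v [dv _]; exists v. Qed.

Lemma ptime_probe_step : ptime N probe_step probe_inp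
  (fun v => Pair (Pair Nil (enc_nat R (element v)))
     (Pair (enc_list (drop (element v).+1 (incidence R (chosen_set v))))
      (Pair (enc_list (rev (take (element v).+1 (incidence R (chosen_set v)))))
       (Pair (@enc_best v (new_best v)) (enc_state v))))).
Proof.
have hid : @ptime R N probes (Do Id) probe_inp probe_inp.
  by apply: ptime_straight => //; apply: pbounded_probe.
have h1 := ptime_fork ptime_candidate hid.
have h2 : @ptime R N probes test_candidate
    (fun v => Pair (candidate_set v) (probe_inp v))
    (fun v => enc_bool R (candidate_at v)).
  apply: ptime_straight => // [|v [mem _]]; first exact: ptime_out h1.
  (* The first unread bit tells whether the element is already chosen; only otherwise is the oracle
     asked about the enlarged set. *)
  rewrite /probe_inp /enc_scan drop_incidence /candidate_at /candidate /=.
  by case: (_ \in chosen v) => //=; rewrite mem.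
have h3 : @ptime R N probes
    (Then (Fork (Then (Do Snd) compute_value) (Do Id)) update_best)
    (fun v => Pair (candidate_set v) (probe_inp v))
    (fun v => @enc_best v
       (if (if best_so_far v is Some e' then
              (value (@A _) (chosen v) e' <=
               value (@A _) (chosen v) (element v))%R
            else true)
        then Some (element v) else best_so_far v)).
  have hsnd : @ptime R N probes (Do Snd)
      (fun v => Pair (candidate_set v) (probe_inp v)) probe_inp.
    by apply: ptime_straight => //; apply: ptime_out h1.
  have hI : @ptime R N probes (Do Id)
      (fun v => Pair (candidate_set v) (probe_inp v))
      (fun v => Pair (candidate_set v) (probe_inp v)).
    by apply: ptime_straight => //; apply: ptime_out h1.
  apply: (ptime_then_straight
    (ptime_fork (ptime_then hsnd ptime_value) hI)) => // v _.
  rewrite /= /probe_inp /enc_scan /=; case: (best_so_far v) => [e|] //=.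
  by case: (value _ _ _ <= value _ _ _)%R.
have h4 : @ptime R N probes
    (If test_candidate
          (Then (Fork (Then (Do Snd) compute_value) (Do Id)) update_best)
          (access [:: Snd; Snd; Snd; Snd; Snd; Fst]))
    (fun v => Pair (candidate_set v) (probe_inp v))
    (fun v => @enc_best v (new_best v)).
  apply: (ptime_if h2).
    apply: ptime_ext (ptime_restrict _ h3) => // v [_ cv].
    by rewrite /new_best /better -/(candidate_at v) cv.
  apply: ptime_straight => // [|v [_ /negPf cv]].
    exact: ptime_inp (ptime_restrict _ h2).
  by rewrite /new_best /better -/(candidate_at v) cv.
have hsnd : @ptime R N probes (Do Snd)
    (fun v => Pair (candidate_set v) (probe_inp v)) probe_inp.
  by apply: ptime_straight => //; apply: ptime_out h1.
apply: (ptime_then_straight (ptime_then h1 (ptime_fork h4 hsnd))) => // v _.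
rewrite /probe_inp /enc_scan drop_incidence.
by rewrite (take_nth Nil) ?size_incidence // nth_incidence inE rev_rcons.
Qed.

Lemma ptime_scan : ptime N (Fold probe_step)
  (fun w : states => Pair (enc_nat R (nreq (C (inst w)))) (@enc_scan w 0 None))
  (fun w => @enc_scan w (nreq (C (inst w)))
     (best (@A _) (system w) (chosen w) (nreq (C (inst w))))).
Proof.
pose acc (w : states) i := @enc_scan w i (best (@A _) (system w) (chosen w) i).
pose l (w : states) : seq (data R) := nseq (nreq (C (inst w))) Nil.
apply: (@ptime_ext _ _ _ _ (fun w => Pair (enc_list (l w)) (acc w 0)) _
  (fun w => acc w (size (l w)))).
- by move=> w _; rewrite /l enc_list_nseq /acc /best take0.
- by move=> w _; rewrite /l size_nseq.
apply: ptime_fold.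
- have S := @pbounded_scale _ states; have c := @pbounded_const _ states.
  apply: pbounded_le (pboundedD (pboundedM (c 2) S) (c 1)) _ => w _.
  by rewrite /l enc_list_nseq dsize_enc_nat; have := nreq_le_scale w; lia.
- apply: (@pbounded_scan states _ id (fun=> 0)
    (fun w => best (@A _) (system w) (chosen w) 0)) => w dw.
  by split=> //; rewrite leq_addr.
apply: (ptime_sub _ ptime_probe_step) => -[w i] [dw]; rewrite /= size_nseq => hi.
pose e := Ordinal hi.
exists (Probe e (best (@A _) (system w) (chosen w) i)); split=> //.
  by rewrite /l nth_nseq if_same.
rewrite /acc /enc_scan /new_best /=.
congr (Pair _ (Pair _ (Pair _ (Pair (enc_best _) _)))).
rewrite /best (take_nth e) ?size_enum_ord // foldl_rcons.
by rewrite (_ : nth e _ _ = e) //; apply: (nth_ord_enum e e).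
Qed.

Lemma ptime_greedy_round : ptime N greedy_round
  (fun w : states => Pair Nil (enc_state w))
  (fun w => enc_state (@State (inst w) (member w) (system w)
              (greedy_step (@A _) (system w) (chosen w)))).
Proof.
have hin : pbounded (fun w : states => dsize N (Pair Nil (enc_state w))).
  apply: (@pbounded_scan states _ id (fun=> 0) (fun=> None)) => w dw.
  by split=> //=; lia.
have h1 : @ptime R N states
    (Fork (access [:: Snd; Fst; Fst])
      (Fork (Do (Const Nil)) (Fork (access [:: Snd; Snd; Fst])
        (Fork (Do (Const Nil)) (Fork (Do (Const Nil)) (access [:: Snd]))))))
    (fun w => Pair Nil (enc_state w))
    (fun w => Pair (enc_nat R (nreq (C (inst w)))) (@enc_scan w 0 None)).
  by apply: ptime_straight => // w _; rewrite /enc_scan drop0 take0.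
apply: (ptime_then_straight (ptime_then h1 ptime_scan)) => // w _.
rewrite /greedy_step /enc_scan /=; case: (best _ _ _ _) => [e|] //=.
by rewrite /enc_state /= set_rcons rev_rcons.
Qed.

(** All [nreq] rounds are run: once no candidate is left, a round leaves the state unchanged. *)
Lemma ptime_greedy_program : ptime N greedy_program
  (fun w : states => enc_covering (C (inst w)) (desc (inst w)))
  (fun w => enc_set R
     [set i in greedy_seq (@A _) (system w) (nreq (C (inst w)))]).
Proof.
pose at_step (w : states) i : states :=
  @State (inst w) (member w) (system w) (greedy_seq (@A _) (system w) i).
pose acc w i := enc_state (at_step w i).
have dom_at_step (w : states) i : dom w -> dom (at_step w i).
  by case=> mem _; split=> //; apply: uniq_greedy_seq.
pose l (w : states) : seq (data R) := nseq (nreq (C (inst w))) Nil.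
have hin : pbounded (fun w : states =>
    dsize N (enc_covering (C (inst w)) (desc (inst w)))).
  exact: (@pbounded_scale _ states).
have h1 : @ptime R N states
    (Fork (access [:: Fst])
      (Fork (Do Id) (Fork (access [:: Fst]) (Do (Const Nil)))))
    (fun w => enc_covering (C (inst w)) (desc (inst w)))
    (fun w => Pair (enc_list (l w)) (acc w 0)).
  apply: ptime_straight => // w _; rewrite /l enc_list_nseq /acc /enc_state /=.
  by rewrite (_ : [set i in _] = set0) ?enc_set0 //; apply/setP => i; rewrite !inE.
have h2 : @ptime R N states (Fold greedy_round)
    (fun w => Pair (enc_list (l w)) (acc w 0)) (fun w => acc w (size (l w))).
  apply: ptime_fold.
  - by apply: pbounded_le (ptime_out h1) _ => w _ /=; lia.
  - by apply: pbounded_le (ptime_out h1) _ => w _ /=; lia.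
  apply: (ptime_sub _ ptime_greedy_round) => -[w i] [dw _].
  by exists (at_step w i); split=> //; [exact: dom_at_step|rewrite nth_nseq if_same].
apply: (ptime_then_straight (ptime_then h1 h2)) => // w _.
by rewrite /acc /l size_nseq.
Qed.

End Algorithm.

(** * The approximation guarantee *)

Local Open Scope ring_scope.

(** [B] is maximal in itself, so [#|B| <= p * #|B|], which is impossible for negative [p] unless [B]
    is empty. *)
Lemma p_system_lt0 (R : realFieldType) n (p : R) (Omega : {set {set 'I_n}}) B :
  p_system p Omega -> p < 0 -> B \in Omega -> B = set0.
Proof.
move=> [_ _ psys] p0 OmB; apply/eqP; rewrite -cards_eq0.
have maxB : maximal_in Omega B B.
  apply/maxsetP; rewrite OmB subxx; split=> // K /andP[_ KB] BK.
  by apply/eqP; rewrite eqEsubset KB.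
apply: contraTT (psys B B B maxB maxB); rewrite -lt0n -ltNge => B0.
by rewrite (@lt_trans _ _ 0) ?ltr0n // nmulr_rlt0 ?ltr0n.
Qed.

Theorem theorem3p1 (R : realFieldType) (N : num_size R) (I : Type)
    (C : I -> covering R) (desc : I -> data R) (alpha_on : I -> R) :
  (exists A : forall x, seq 'I_(nreq (C x)) -> {set 'I_(nelt (C x))},
     [/\ forall x, online_algorithm (A x),
         forall x, competitive (alpha_on x) (A x) &
         polytime_online N desc A]) ->
  exists (P : prog R) (k : nat),
    forall (x : I) (Omega : {set {set 'I_(nreq (C x))}}) (p : R)
           (O : data R -> bool),
      p_system p Omega -> membership_oracle O Omega ->
      exists2 D : {set 'I_(nreq (C x))},
        runs_within N O P k (enc_covering (C x) (desc x)) (enc_set R D) &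
        D \in Omega /\ maxmin Omega <= (p + 1) * alpha_on x * Opt D.
Proof.
move=> [A [onA compA [online [k [_ onlineP]]]]].
have [K runK] := ptime_greedy_program onlineP.
(* One number serves as factor and exponent. For input size [S >= 1],
   [(S + 2) ^ K <= 3 ^ K * S ^ K], and [K <= 3 ^ K] lets the exponent be raised. *)
exists (greedy_program online), (3 ^ K)%N => x Omega p O psys memO.
set s := greedy_seq (A x) Omega (nreq (C x)).
exists [set i in s].
  have [t rt lt] := runK (@State R I C x O Omega [::]) (conj memO isT).
  exists t => //; have := dsize_gt0 N (enc_covering (C x) (desc x)).
  move: (dsize N _) (lt : (t <= (dsize N (enc_covering (C x) (desc x))).+2 ^ K)%N).
  move=> S {}lt S0; apply: leq_trans lt _; apply: leq_trans (leq_addr _ _).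
  apply: (@leq_trans (3 ^ K * S ^ K)%N).
    by rewrite -expnMn; case: (K) => // m; rewrite leq_exp2r //; lia.
  by rewrite leq_mul2l leq_pexp2l ?orbT // ltnW // ltn_expl.
have Oms : [set i in s] \in Omega by apply: greedy_seq_in; case: psys.
(* For negative [p] every member of [Omega] is empty, so [Opt] vanishes on both sides. *)
split=> //; case: (ltP p 0) => p0.
  rewrite (p_system_lt0 psys p0 Oms) Opt0 mulr0; apply: bigmax_le => // B OmB.
  by rewrite (p_system_lt0 psys p0 OmB) Opt0.
have le_s : (p + 1) * cost (A x s) <= (p + 1) * alpha_on x * Opt [set i in s].
  by rewrite -mulrA ler_wpM2l ?addr_ge0 //; apply: compA.
apply: bigmax_le => [|B OmB]; apply: le_trans le_s.
  by rewrite mulr_ge0 ?cost_ge0 ?addr_ge0.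
apply: greedy_bound OmB => //; first exact: uniq_greedy_seq.
- by move=> j e; apply: greedy_seq_greedy.
- by move=> e; apply: greedy_seq_final.
Qed.
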